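(* Let $P\in\mathbb{C}[y]$ with $\deg P\geq 2$, $\delta\in\mathbb{C}\setminus\{0\}$, $h_1(x,y)=(y,P(y)-\delta x)$, $\theta\in(0,2\pi)\setminus\{\frac{\pi}{2},\pi,\frac{3\pi}{2}\}$, $R_\theta$ the linear map of $\mathbb{C}^2$ with matrix $\begin{pmatrix}\cos\theta&-\sin\theta\\ \sin\theta&\cos\theta\end{pmatrix}$, $h_2=R_\theta^{-1}\circ h_1\circ R_\theta$ and $G=\langle h_1,h_2\rangle$. Let $\nu=a_1\delta_{h_1}+a_2\delta_{h_2}+a_3\delta_{h_1^{-1}}+a_4\delta_{h_2^{-1}}$ with $a_i>0$ for each $i$ and $\sum_{i=1}^4a_i=1$. If the filled Julia sets $K(h_1)$ and $K(h_2)$ are disjoint, then there is no $\nu$-stationary Borel probability measure on $\mathbb{C}^2$.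
   Context: For an automorphism $h$ of $\mathbb{C}^2$, the filled Julia set is $K(h)=\{(x,y)\in\mathbb{C}^2:(h^n(x,y))_{n\in\mathbb{Z}}\text{ is bounded}\}$. A Borel probability measure $\mu$ on $\mathbb{C}^2$ is $\nu$-stationary if $\mu=a_1(h_1)_*\mu+a_2(h_2)_*\mu+a_3(h_1^{-1})_*\mu+a_4(h_2^{-1})_*\mu$. *)

(* Defs.v *)
From HB Require Import structures.
From mathcomp Require Import all_boot all_order all_algebra.
From mathcomp Require Import all_classical all_reals all_analysis.
From mathcomp Require Import complex.
Set Implicit Arguments. Unset Strict Implicit. Unset Printing Implicit Defensive.
Import Order.TTheory GRing.Theory Num.Theory.
Local Open Scope classical_set_scope.
Local Open Scope ring_scope.

Section Defs.
Variable R : realType.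

Definition C2 := (complex R * complex R)%type.

(* Underlying measurable space: C^2 = R^4 with its Borel sigma-algebra,
   realized as the product sigma-algebra on (R*R)*(R*R)
   (equal to the Borel sigma-algebra of R^4 = C^2 since R is second countable).
   ((a,b),(c,d)) stands for (a + i b, c + i d). *)
Definition R4 := ((R * R) * (R * R))%type.
Definition to_C2 (p : R4) : C2 := ((p.1.1 +i* p.1.2)%C, (p.2.1 +i* p.2.2)%C).
Definition of_C2 (z : C2) : R4 :=
  ((complex.Re z.1, complex.Im z.1), (complex.Re z.2, complex.Im z.2)).
Definition onR4 (f : C2 -> C2) : R4 -> R4 := fun p => of_C2 (f (to_C2 p)).

Definition henon (P : {poly complex R}) (delta : complex R) (z : C2) : C2 :=
  (z.2, P.[z.2] - delta * z.1).
Definition henon_inv (P : {poly complex R}) (delta : complex R) (z : C2) : C2 :=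
  ((P.[z.1] - z.2) / delta, z.1).

Definition rotC2 (t : R) (z : C2) : C2 :=
  ((cos t)%:C%C * z.1 - (sin t)%:C%C * z.2, (sin t)%:C%C * z.1 + (cos t)%:C%C * z.2).

Definition iterz (h hinv : C2 -> C2) (n : int) : C2 -> C2 :=
  match n with
  | Posz k => iter k h
  | Negz k => iter k.+1 hinv
  end.

Definition filled_julia (h hinv : C2 -> C2) : set C2 :=
  [set z | exists M : R, forall n : int,
      `|(iterz h hinv n z).1| <= M%:C%C /\ `|(iterz h hinv n z).2| <= M%:C%C].

Definition stationary (mu : set R4 -> \bar R) (a1 a2 a3 a4 : R)
  (h1 h2 h1i h2i : C2 -> C2) : Prop :=
  forall A : set R4, measurable A ->
    mu A = (a1%:E * mu (onR4 h1 @^-1` A) + a2%:E * mu (onR4 h2 @^-1` A)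
           + a3%:E * mu (onR4 h1i @^-1` A) + a4%:E * mu (onR4 h2i @^-1` A))%E.

End Defs.

(* Main.v *)
(** Let [B] be a large ball. Near infinity the generators [h1], [h2] and their
    inverses have attracting cones [U t], pairwise disjoint because [theta] is
    not a multiple of [pi / 2], and [h t] maps the complement of
    [B] and [U t^-1] into [U t]. Hence a walk starting in [U s] can return to
    [B] only by cancelling the letter [s] in the free group, and weights of the
    form [q t = 1 - e / a t^-1] bound the probability of that, so the
    probability of ever hitting [B] from outside is at most some [Q < 1].
    If [mu] is stationary, this forces the walk to stay in [B] once it is there,
    [mu]-almost surely. Taking [B] with [mu B > 0], some point of [B] has all its
    iterates under [h1], [h2] and their inverses in [B]: it lies in both filled
    Julia sets. *)

Require Import Defs.
From HB Require Import structures.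
From mathcomp Require Import all_boot all_order all_algebra.
From mathcomp Require Import all_classical all_reals all_analysis.
From mathcomp Require Import complex.
From mathcomp Require Import measurable_realfun ring lra.
Import Order.TTheory GRing.Theory Num.Theory.
Local Open Scope classical_set_scope.
Local Open Scope ring_scope.

(** * Hitting probabilities of a random walk generated by finitely many maps *)

Section HittingProbability.
Context {R : realType} {T : Type} {I : finType}.
Variables (inv : I -> I) (h : I -> T -> T) (a : I -> R) (B : set T).
Hypothesis a_ge0 : forall t, 0 <= a t.
Hypothesis a_sum : \sum_t a t = 1.

Definition transition (f : T -> R) (x : T) : R := \sum_t a t * f (h t x).

(** This is the probability that the walk from [x] meets [B] at one of the times [0, ..., n - 1];
    thus [hitting 1] is [\1_B]. The indicator form, rather than a case split, gives measurability at
    once and isolates the increment carried by [B]. *)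
Fixpoint hitting (n : nat) : T -> R :=
  if n is m.+1 then
    fun x => transition (hitting m) x + \1_B x * (1 - transition (hitting m) x)
  else fun=> 0.

Lemma transition_ge0 (f : T -> R) x : (forall y, 0 <= f y) -> 0 <= transition f x.
Proof. by move=> f0; apply: sumr_ge0 => t _; rewrite mulr_ge0. Qed.

Lemma transition_le1 (f : T -> R) x : (forall y, f y <= 1) -> transition f x <= 1.
Proof.
by move=> f1; rewrite -a_sum; apply: ler_sum => t _; rewrite ler_piMr.
Qed.

Lemma hitting_ge0_le1 n x : 0 <= hitting n x <= 1.
Proof.
elim: n x => [|n IH] x /=; first by rewrite lexx ler01.
have p0 : 0 <= transition (hitting n) x.
  by apply: transition_ge0 => y; case/andP: (IH y).
have p1 : transition (hitting n) x <= 1.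
  by apply: transition_le1 => y; case/andP: (IH y).
by rewrite indicE; case: (x \in B) => /=; lra.
Qed.

Lemma hitting_out n x : ~ B x -> hitting n.+1 x = transition (hitting n) x.
Proof. by move=> nBx /=; rewrite indicE memNset// mul0r addr0. Qed.

Variables (U : I -> set T) (q : I -> R) (Q : R).
Hypothesis hK : forall t, cancel (h t) (h (inv t)).
Hypothesis invK : involutive inv.
Hypothesis U_out : forall t x, U t x -> ~ B x.
Hypothesis U_disj : forall s t x, U s x -> U t x -> s = t.
Hypothesis U_step : forall t x, ~ B x -> ~ U (inv t) x -> U t (h t x).
Hypothesis q_ge0 : forall t, 0 <= q t.
Hypothesis q_leQ : forall t, q t <= Q.
Hypothesis q_super : forall s,
  a (inv s) + \sum_(t | t != inv s) a t * (q t * q s) <= q s.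

(* [tower x s v]: x is the image of a point of some [U s0] under a reduced word
   of the free group ending with the letter [s], and [v] is the product of the
   weights [q] along it. *)
Inductive tower : T -> I -> R -> Prop :=
| tower_base x s : U s x -> tower x s (q s)
| tower_step x s v t :
    tower x s v -> t != inv s -> tower (h t x) t (q t * v).

Lemma tower_ge0 x s v : tower x s v -> 0 <= v.
Proof. by elim=> [y t _|y s' v' t _ v0 _]; rewrite ?mulr_ge0. Qed.

Lemma tower_U x s v : tower x s v -> U s x.
Proof.
elim=> // y s' v' t _ Uy tNs; apply: U_step; first exact: U_out Uy.
by move=> /(U_disj _ _ _ Uy) es; rewrite es invK eqxx in tNs.
Qed.

(** Induction on time. From a tower ending with [s], any letter other than [inv s] lengthens the
    word and multiplies the bound by one more weight, while [inv s] shortens it; [q_super] says that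
    the average of these bounds is at most the current one. *)
Lemma hitting_tower n x s v : tower x s v -> hitting n x <= v.
Proof.
elim: n x s v => [|n IH] x s v Dx; first exact: tower_ge0 Dx.
rewrite hitting_out; last exact: U_out (tower_U _ _ _ Dx).
rewrite /transition (bigD1 (inv s))//=.
(* For a word with no letter to cancel, the move [inv s] may enter [B], and its hitting probability
   is bounded by 1 only. *)
case: Dx (Dx) => {x s v} [x s Ux|x s v t Dx tNs] Dx'.
  apply: le_trans (q_super s); apply: lerD.
    by apply: ler_piMr => //; case/andP: (hitting_ge0_le1 n (h (inv s) x)).
  by apply: ler_sum => t tNs; apply: ler_wpM2l => //; apply: IH; apply: tower_step Dx' tNs.
(* The letter [inv t] undoes the last step and returns to the shorter tower of weight [v]. *)
rewrite hK.
apply: (@le_trans _ _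
   ((a (inv t) + \sum_(r | r != inv t) a r * (q r * q t)) * v)).
  rewrite mulrDl mulr_suml; apply: lerD.
    by apply: ler_wpM2l => //; apply: IH Dx.
  apply: ler_sum => r rNt; rewrite -!mulrA; apply: ler_wpM2l => //.
  by apply: IH; apply: tower_step Dx' rNt.
by apply: ler_wpM2r; [exact: tower_ge0 Dx | exact: q_super].
Qed.

(** A point outside [B] and in no [U s] is sent by every letter [t] into [U t], so its hitting
    probability is an average of numbers bounded by the [q t]. *)
Lemma hitting_le_out n x : 0 <= Q -> ~ B x -> hitting n x <= Q.
Proof.
move=> Q0 nBx.
have [[s Us]|noU] := pselect (exists s, U s x).
  by apply: le_trans (q_leQ s); apply: hitting_tower; apply: tower_base Us.
case: n => // n; rewrite hitting_out//.
rewrite -[leRHS]mul1r -a_sum mulr_suml; apply: ler_sum => t _.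
apply: ler_wpM2l => //; apply: le_trans (q_leQ t).
apply: (@hitting_tower _ _ t); apply: tower_base; apply: U_step => // Ux.
by apply: noU; exists (inv t).
Qed.

(** With probability [a t] the walk takes the letter [t] out of [B], and then it fails to return
    with probability at least [1 - Q]. *)
Lemma transition_hitting_le n t x : 0 <= Q -> ~ B (h t x) ->
  transition (hitting n) x <= 1 - a t * (1 - Q).
Proof.
move=> Q0 nB; rewrite /transition (bigD1 t)//=.
have atQ := ler_wpM2l (a_ge0 t) (hitting_le_out n _ Q0 nB).
have rest : \sum_(s | s != t) a s * hitting n (h s x) <= 1 - a t.
  rewrite -a_sum [X in _ <= X - _](bigD1 t)//= addrAC subrr add0r; apply: ler_sum => s _.
  by apply: ler_piMr => //; case/andP: (hitting_ge0_le1 n (h s x)).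
lra.
Qed.

End HittingProbability.

(** * Stationary probability measures *)

Section StationaryMeasure.
Context {d : measure_display} {T : measurableType d} {R : realType} {I : finType}.
Variables (mu : probability T R) (h : I -> T -> T) (a : I -> R).
Hypothesis mh : forall t, measurable_fun setT (h t).
Hypothesis a_gt0 : forall t, 0 < a t.
Hypothesis mu_stat : forall A, measurable A ->
  mu A = (\sum_t (a t)%:E * mu (h t @^-1` A))%E.

Let a_ge0 t : 0 <= a t. Proof. exact: ltW. Qed.

(** Realizing the right-hand side of the stationarity equation as a measure turns that equation on
    sets into one on integrals. Working with lists allows the measure to be built one letter at a
    time. *)
Lemma weighted_pushforward (s : seq I) :
  exists nu : {measure set T -> \bar R},
    (forall A, measurable A ->
      nu A = (\sum_(t <- s) (a t)%:E * mu (h t @^-1` A))%E) /\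
    (forall f : T -> \bar R, measurable_fun setT f -> (forall x, (0 <= f x)%E) ->
      (\int[nu]_x f x = \sum_(t <- s) (a t)%:E * \int[mu]_x f (h t x))%E).
Proof.
elim: s => [|t s [nu [nuE nuI]]].
  exists mzero; split=> [A _|f _ _]; first by rewrite big_nil.
  by rewrite integral_measure_zero big_nil.
pose ht := measure_function_pushforward__canonical__measure_function_Measure mu (mh t).
exists (measure_add (mscale (NngNum (a_ge0 t)) ht) nu).
split=> [A mA|f mf f0].
  rewrite big_cons -nuE//; exact: measure_addE.
rewrite ge0_integral_measure_add// big_cons nuI//; congr (_ + _)%E.
by rewrite ge0_integral_mscale//= ge0_integral_pushforward.
Qed.

Lemma stationary_integral (f : T -> R) : measurable_fun setT f ->
  (forall x, 0 <= f x) ->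
  (\int[mu]_x (transition h a f x)%:E = \int[mu]_x (f x)%:E)%E.
Proof.
move=> mf f0; have [nu [nuE nuI]] := weighted_pushforward (index_enum I).
rewrite [RHS](@eq_measure_integral _ _ _ _ nu); last first.
  by move=> A mA _; rewrite nuE//; exact: mu_stat.
rewrite nuI; [|exact/measurable_EFinP|by move=> x; rewrite lee_fin].
under eq_integral do rewrite -sumEFin.
have mfh t : measurable_fun setT (fun x => (f (h t x))%:E).
  by apply/measurable_EFinP; apply: measurableT_comp.
rewrite ge0_integral_sum//; last 2 first.
- by move=> t; under eq_fun do rewrite EFinM; exact: measurable_funeM.
- by move=> t x _; rewrite lee_fin mulr_ge0.
apply: eq_bigr => t _; under eq_integral do rewrite EFinM.
by rewrite ge0_integralZl ?lee_fin// => x _; rewrite lee_fin.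
Qed.

Lemma measurable_transition (f : T -> R) : measurable_fun setT f ->
  measurable_fun setT (transition h a f).
Proof.
move=> mf; apply: measurable_sum => t; apply: measurable_funM => //.
exact: measurableT_comp.
Qed.

Lemma measurable_hitting (B : set T) n : measurable B ->
  measurable_fun setT (hitting h a B n).
Proof.
move=> mB; elim: n => [|n IH] /=; first exact: measurable_cst.
have mt := measurable_transition _ IH.
apply: measurable_funD => //; apply: measurable_funM.
  exact: measurable_indic.
exact: measurable_funB.
Qed.

Lemma stationary_preimage_null (A : set T) t :
  measurable A -> mu A = 0%E -> mu (h t @^-1` A) = 0%E.
Proof.
move=> mA; rewrite mu_stat// => /eqP; rewrite seq_psume_eq0; last first.
  by move=> s _; rewrite mule_ge0 ?lee_fin.
move=> /allP /(_ t); rewrite mem_index_enum => /(_ isT) /=.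
by rewrite mule_eq0 eqe gt_eqF//= => /eqP.
Qed.

Hypothesis a_sum : \sum_t a t = 1.

(* [\int f_{n+1} = \int f_n + \int_B (1 - P f_n)] for the hitting probabilities
   [f_n] of [B], while all these integrals are at most 1; hence [1 - P f_n]
   cannot stay bounded below on a non-null part of [B]. *)
Lemma stationary_no_escape (B C : set T) (c : R) :
  measurable B -> measurable C -> C `<=` B -> 0 < c ->
  (forall n x, C x -> transition h a (hitting h a B n) x <= 1 - c) ->
  mu C = 0%E.
Proof.
move=> mB mC CB c0 Cc.
have f01 := hitting_ge0_le1 h a B a_ge0 a_sum.
have f0 n x : 0 <= hitting h a B n x by case/andP: (f01 n x).
have f1 n x : hitting h a B n x <= 1 by case/andP: (f01 n x).
pose F n := (\int[mu]_x (hitting h a B n x)%:E)%E.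
have FS n : (F n + c%:E * mu C <= F n.+1)%E.
  have mt := measurable_transition _ (measurable_hitting _ n mB).
  rewrite /F -(stationary_integral _ (measurable_hitting _ n mB))//.
  rewrite -[C in mu C]setIT -integral_indic//.
  have mC1 : measurable_fun setT (fun x => (\1_C x)%:E : \bar R).
    by apply/measurable_EFinP; exact: measurable_indic.
  rewrite -ge0_integralZl//; last by rewrite lee_fin ltW.
  have cC0 x : (0 <= c%:E * (\1_C x)%:E)%E.
    by rewrite -EFinM lee_fin indicE mulr_ge0// ltW.
  have t0 x : 0 <= transition h a (hitting h a B n) x by exact: transition_ge0.
  rewrite -ge0_integralD//; last 3 first.
  - by move=> x _; rewrite lee_fin.
  - exact/measurable_EFinP.
  - exact: measurable_funeM.
  apply: ge0_le_integral => //.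
  - by move=> x _; rewrite adde_ge0 ?cC0// lee_fin.
  - apply: emeasurable_funD; first exact/measurable_EFinP.
    exact: measurable_funeM.
  - by apply/measurable_EFinP; exact: measurable_hitting.
  - move=> x _; rewrite -EFinM -EFinD lee_fin /= lerD2l.
    rewrite !indicE; have [xC|xC] := boolP (x \in C).
      rewrite mem_set; last by apply: CB; exact: set_mem.
      by have := Cc n _ (set_mem xC) => /=; lra.
    by rewrite mulr0 mulr_ge0// subr_ge0 transition_le1.
have Fn n : (n%:R%:E * (c%:E * mu C) <= F n)%E.
  elim: n => [|n IH]; first by rewrite mul0e integral_ge0// => x _; rewrite lee_fin.
  apply: le_trans (FS n); rewrite -natr1 EFinD ge0_muleDl ?lee_fin// mul1e.
  exact: leeD2r.
have F1 n : (F n <= 1)%E.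
  rewrite -(probability_setT mu) -[leRHS]mul1e -integral_cst//.
  apply: ge0_le_integral => //.
  - by move=> x _; rewrite lee_fin.
  - by apply/measurable_EFinP; exact: measurable_hitting.
  - by move=> x _; rewrite lee_fin.
have muCf : mu C \is a fin_num by exact: fin_num_measure.
rewrite -(fineK muCf); congr (_%:E); apply/eqP; rewrite eq_le fine_ge0// andbT leNgt.
apply/negP => C0.
have ccC : 0 < c * fine (mu C) by rewrite mulr_gt0.
have [n nP] : exists n : nat, 1 < n%:R * (c * fine (mu C)).
  exists (Num.bound (c * fine (mu C))^-1).
  rewrite -ltr_pdivrMr// div1r; apply: archi_boundP.
  by rewrite invr_ge0 ltW.
have := le_trans (Fn n) (F1 n).
by rewrite -(fineK muCf) -!EFinM lee_fin leNgt nP.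
Qed.

(** An orbit of [h t] leaving [B] for the first time after [k] steps starts in the [k]-th preimage
    of the escape set. Each such preimage is null by stationarity and positivity of the weights, and
    there are countably many of them, so they cannot cover [B]. *)
Lemma stationary_trapped (B : set T) : measurable B -> mu B != 0%E ->
  (forall t, mu (B `&` h t @^-1` (~` B)) = 0%E) ->
  exists2 x, B x & forall t k, B (iter k (h t) x).
Proof.
move=> mB B0 escape0.
pose E t := B `&` h t @^-1` (~` B).
have mpre t A : measurable A -> measurable (h t @^-1` A).
  by move=> mA; rewrite -[X in measurable X]setTI; exact: mh.
have mE t : measurable (E t).
  by apply: measurableI => //; apply: mpre; exact: measurableC.
have Ek t k : measurable (iter k (h t) @^-1` E t) /\ mu (iter k (h t) @^-1` E t) = 0%E.
  elim: k => [|k [mk muk]]; first by split; [exact: mE|exact: escape0].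
  have -> : iter k.+1 (h t) @^-1` E t = h t @^-1` (iter k (h t) @^-1` E t).
    by apply/seteqP; split=> x; rewrite /preimage /= -iterSr.
  by split; [exact: mpre|exact: stationary_preimage_null].
pose N := \big[setU/set0]_t \bigcup_k (iter k (h t) @^-1` E t).
have N0 : mu.-negligible N.
  apply: big_ind => [||t _]; first exact: negligible_set0.
    by move=> ? ?; exact: negligibleU.
  apply: negligible_bigcup => k; have [mk muk] := Ek t k.
  by exists (iter k (h t) @^-1` E t); split.
have [BN|] := pselect (B `<=` N).
  by move: B0; rewrite (measure_negligible mB) ?eqxx//; exact: negligibleS BN N0.
move=> /nonsubset [x [Bx nNx]]; exists x => // t; elim=> [//|k IH].
apply: contrapT => nB; apply: nNx; rewrite /N (bigD1 t)//=; left.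
by exists k.
Qed.

End StationaryMeasure.

(** * Superharmonic weights on the free group of rank two *)

Section FreeGroupWeights.
Context {R : realFieldType}.

(** In a letter, the first boolean selects the generator and the second one tells whether it is
    inverted. *)
Definition letter_inv (t : bool * bool) : bool * bool := (t.1, ~~ t.2).

Lemma letter_invK : involutive letter_inv.
Proof. by case=> b c; rewrite /letter_inv /= negbK. Qed.

Lemma divrD_ge2 (x y : R) : 0 < x -> 0 < y -> 2 <= x / y + y / x.
Proof.
move=> x0 y0; have -> : x / y + y / x = 2 + (x - y) ^+ 2 / (x * y).
  by field; rewrite !gt_eqF.
by rewrite lerDl divr_ge0 ?sqr_ge0// mulr_ge0 ?ltW.
Qed.

Variable a : bool * bool -> R.
Hypothesis a_gt0 : forall t, 0 < a t.
Hypothesis a_sum : \sum_t a t = 1.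

(** The generator not involved in [s] contributes both of its letters, whose ratios are [x / y] and
    [y / x]. *)
Lemma sum_ratio_ge2 s : 2 <= \sum_(t | t != s) a t / a (letter_inv t).
Proof.
case: s => b c.
rewrite (bigD1 (~~ b, true)) ?xpair_eqE; last by case: b.
rewrite (bigD1 (~~ b, false)) ?xpair_eqE; last by case: b.
rewrite /= addrA; apply: (le_trans (divrD_ge2 _ _ (a_gt0 (~~ b, true)) (a_gt0 (~~ b, false)))).
by rewrite lerDl sumr_ge0// => t _; rewrite divr_ge0 ?ltW.
Qed.

(* To first order in [e], with [q t = 1 - e_t], the inequality reads
   [a (inv s) * e_s < \sum_(t != inv s) a t * e_t]; taking [e_t] proportional to
   [1 / a (inv t)] makes it [1 < \sum_(t != inv s) a t / a (inv t)]. *)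
Lemma superharmonic_weights : exists (q : bool * bool -> R) (Q : R),
  [/\ 0 <= Q < 1, forall t, 0 <= q t, forall t, q t <= Q &
   forall s, a (letter_inv s)
     + \sum_(t | t != letter_inv s) a t * (q t * q s) <= q s].
Proof.
have a_le1 t : a t <= 1.
  rewrite -a_sum (bigD1 t)//= lerDl sumr_ge0// => s _; exact: ltW.
(* All weights are at most 1, so this [e] is at most half of each of them. *)
pose e := (\prod_t a t) / 2.
have e0 : 0 < e by rewrite divr_gt0// prodr_gt0.
have ea t : e <= a t / 2.
  rewrite ler_pM2r// (bigD1 t)//=; apply: ler_piMr; first exact: ltW.
  by apply: prodr_ile1 => s _; rewrite ltW//=.
have eV t : e / a t <= 1 / 2.
  by rewrite ler_pdivrMr//; have := ea t; lra.
have e2 : e <= 1 / 2 by have := ea (true, true); have := a_le1 (true, true); lra.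
exists (fun t => 1 - e / a (letter_inv t)), (1 - e); split.
- lra.
- by move=> t; have := eV (letter_inv t); lra.
- move=> t; rewrite lerD2l lerN2 ler_pdivlMr//.
  by apply: ler_piMr => //; exact: ltW.
move=> s; set s' := letter_inv s.
have -> : \sum_(t | t != s') a t * ((1 - e / a (letter_inv t)) * (1 - e / a s'))
   = (1 - a s' - e * \sum_(t | t != s') a t / a (letter_inv t)) * (1 - e / a s').
  have -> : 1 - a s' = \sum_(t | t != s') a t.
    by rewrite -a_sum (bigD1 s')//= addrAC subrr add0r.
  rewrite mulr_sumr -sumrB mulr_suml; apply: eq_bigr => t _; ring.
(* With [x = e / a s'], the inequality reduces to [e <= e * S * (1 - x)], which follows from
   [S >= 2] and [x <= 1 / 2]. *)
have S2 := sum_ratio_ge2 s'; set S := \sum_(t | _) _ in S2 *.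
have es' : e / a s' * a s' = e by rewrite mulfVK// gt_eqF.
have := eV s'; move: es'; set x := e / a s' => xa x2.
have eS : e * 2 <= e * S by rewrite ler_pM2l.
have : e * 2 * (1 - x) <= e * S * (1 - x) by rewrite ler_wpM2r//; lra.
have : e * x <= e * (1 / 2) by rewrite ler_pM2l.
nra.
Qed.

End FreeGroupWeights.

(** * Ping-pong dynamics and a stationary measure give trapped orbits *)

Section PingPong.
Context {d : measure_display} {T : measurableType d} {R : realType}.

Lemma pingpong_trapped (mu : probability T R) (h : bool * bool -> T -> T)
    (a : bool * bool -> R) (B : set T) (U : bool * bool -> set T) :
  (forall t, measurable_fun setT (h t)) ->
  (forall t, 0 < a t) -> \sum_t a t = 1 ->
  (forall A, measurable A -> mu A = (\sum_t (a t)%:E * mu (h t @^-1` A))%E) ->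
  measurable B -> mu B != 0%E ->
  (forall t, cancel (h t) (h (letter_inv t))) ->
  (forall t x, U t x -> ~ B x) ->
  (forall s t x, U s x -> U t x -> s = t) ->
  (forall t x, ~ B x -> ~ U (letter_inv t) x -> U t (h t x)) ->
  exists2 x, B x & forall t k, B (iter k (h t) x).
Proof.
move=> mh a0 a1 stat mB B0 hK U_out U_disj U_step.
have a0' t : 0 <= a t by exact: ltW.
apply: (stationary_trapped mu h a mh a0 stat B mB B0) => t.
have [q [Q [/andP[Q0 Q1] q0 qQ qs]]] := superharmonic_weights a a0 a1.
apply: (stationary_no_escape mu h a mh a0 stat a1 B _ (a t * (1 - Q))) => //.
- apply: measurableI => //; rewrite -[X in measurable X]setTI.
  by apply: mh => //; exact: measurableC.
- by apply: mulr_gt0 => //; rewrite subr_gt0.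
- move=> n x [_ nBx].
  exact: (transition_hitting_le letter_inv h a B a0' a1 U q Q hK letter_invK).
Qed.

End PingPong.

(** * Measurability of complex-valued functions *)

Section Measurability.
Context {d : measure_display} {T : measurableType d} {R : realType}.
Implicit Types f g : T -> complex R.

Definition cmeasurable f : Prop :=
  measurable_fun setT (fun x => complex.Re (f x)) /\
  measurable_fun setT (fun x => complex.Im (f x)).

Lemma cmeasurable_cst (c : complex R) : cmeasurable (fun=> c).
Proof. by split; exact: measurable_cst. Qed.

Lemma cmeasurableB f g : cmeasurable f -> cmeasurable g ->
  cmeasurable (fun x => f x - g x).
Proof.
move=> [fr fi] [gr gi]; split.
  rewrite [X in measurable_fun _ X](_ : _ = fun x => complex.Re (f x) - complex.Re (g x)).
    exact: measurable_funB.
  by apply/funext => x; case: (f x) => ? ?; case: (g x).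
rewrite [X in measurable_fun _ X](_ : _ = fun x => complex.Im (f x) - complex.Im (g x)).
  exact: measurable_funB.
by apply/funext => x; case: (f x) => ? ?; case: (g x).
Qed.

Lemma cmeasurableD f g : cmeasurable f -> cmeasurable g ->
  cmeasurable (fun x => f x + g x).
Proof.
move=> mf mg; have := cmeasurableB _ _ mf (cmeasurableB _ _ (cmeasurable_cst 0) mg).
by under eq_fun do rewrite sub0r opprK.
Qed.

Lemma cmeasurableM f g : cmeasurable f -> cmeasurable g ->
  cmeasurable (fun x => f x * g x).
Proof.
move=> [fr fi] [gr gi]; split.
  rewrite [X in measurable_fun _ X](_ : _ = fun x =>
    complex.Re (f x) * complex.Re (g x) - complex.Im (f x) * complex.Im (g x)).
    by apply: measurable_funB; exact: measurable_funM.
  by apply/funext => x; case: (f x) => ? ?; case: (g x).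
rewrite [X in measurable_fun _ X](_ : _ = fun x =>
  complex.Re (f x) * complex.Im (g x) + complex.Im (f x) * complex.Re (g x)).
  by apply: measurable_funD; exact: measurable_funM.
by apply/funext => x; case: (f x) => ? ?; case: (g x).
Qed.

Lemma cmeasurable_horner (P : {poly complex R}) f :
  cmeasurable f -> cmeasurable (fun x => P.[f x]).
Proof.
move=> mf; elim/poly_ind: P => [|P c IH].
  by under eq_fun do rewrite horner0; exact: cmeasurable_cst.
under eq_fun do rewrite hornerMXaddC.
by apply: cmeasurableD (cmeasurable_cst c); exact: cmeasurableM.
Qed.

End Measurability.

(** * Measurability of self-maps of the complex plane of dimension two *)

Section MeasurableC2.
Context {R : realType}.

(** Quantifying over measurable parametrizations [g] by [R4] makes stability under composition
    immediate. *)
Definition C2_measurable (F : C2 R -> C2 R) : Prop :=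
  forall g : R4 R -> C2 R,
    cmeasurable (fun p => (g p).1) -> cmeasurable (fun p => (g p).2) ->
    cmeasurable (fun p => (F (g p)).1) /\ cmeasurable (fun p => (F (g p)).2).

Lemma C2_measurable_comp F G :
  C2_measurable F -> C2_measurable G -> C2_measurable (F \o G).
Proof. by move=> mF mG g g1 g2; have [G1 G2] := mG g g1 g2; exact: (mF (G \o g)). Qed.

Lemma C2_measurable_henon P delta : C2_measurable (henon P delta).
Proof.
move=> g g1 g2; split=> //=; apply: cmeasurableB; first exact: cmeasurable_horner.
by apply: cmeasurableM => //; exact: cmeasurable_cst.
Qed.

Lemma C2_measurable_henon_inv P delta : C2_measurable (henon_inv P delta).
Proof.
move=> g g1 g2; split=> //=; apply: cmeasurableM; last exact: cmeasurable_cst.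
by apply: cmeasurableB => //; exact: cmeasurable_horner.
Qed.

Lemma C2_measurable_rot t : C2_measurable (rotC2 t).
Proof.
move=> g g1 g2; split=> /=; [apply: cmeasurableB|apply: cmeasurableD];
  by apply: cmeasurableM => //; exact: cmeasurable_cst.
Qed.

Lemma measurable_to_C2 : cmeasurable (fun p : R4 R => (to_C2 p).1) /\
  cmeasurable (fun p : R4 R => (to_C2 p).2).
Proof.
by split; split=> /=; apply: measurableT_comp => //.
Qed.

Lemma measurable_onR4 F : C2_measurable F -> measurable_fun setT (onR4 F).
Proof.
move=> mF; have [t1 t2] := measurable_to_C2.
have [[a b] [c e]] := mF _ t1 t2.
by apply: measurable_fun_pair; exact: measurable_fun_pair.
Qed.

(** The squared Hermitian norm is invariant under [rotC2], so one ball serves both generators. *)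
Definition sqn (z : C2 R) : R :=
  complex.Re z.1 ^+ 2 + complex.Im z.1 ^+ 2 +
  (complex.Re z.2 ^+ 2 + complex.Im z.2 ^+ 2).

Lemma measurable_sqn_ball (r : R) :
  measurable [set p : R4 R | sqn (to_C2 p) <= r].
Proof.
have [[a b] [c e]] := measurable_to_C2.
rewrite -[X in measurable X]setTI; apply: measurable_fun_le => //.
by do 2 apply: measurable_funD; exact: measurable_funX.
Qed.

End MeasurableC2.

(** * Attracting cones of Hénon maps at infinity *)

Section HenonCones.
Context {R : realType}.
Local Notation nn := (@ComplexField.Normc.normc R).
Implicit Types (P : {poly complex R}) (delta x y : complex R) (z : C2 R).

Lemma normc_nneg x : 0 <= nn x.
Proof. by case: x => u v; exact: sqrtr_ge0. Qed.

Lemma normcB_ge x y : nn x - nn y <= nn (x - y).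
Proof.
have := le_normcD (x - y) y; rewrite subrK; lra.
Qed.

Lemma normcD_ge x y : nn x - nn y <= nn (x + y).
Proof. by have := normcB_ge x (- y); rewrite opprK normcN. Qed.

Lemma normc_real (t : R) : nn t%:C%C = `|t|.
Proof. by rewrite /ComplexField.Normc.normc /= expr0n addr0 sqrtr_sqr. Qed.

Lemma sqr_normcE x : nn x ^+ 2 = complex.Re x ^+ 2 + complex.Im x ^+ 2.
Proof. by case: x => u v /=; rewrite sqr_sqrtr// addr_ge0 ?sqr_ge0. Qed.

Lemma sqnE z : sqn z = nn z.1 ^+ 2 + nn z.2 ^+ 2.
Proof. by rewrite !sqr_normcE. Qed.

(** Write the polynomial as [P * 'X + c]. If [P] is constant the bound is explicit; otherwise
    induction with bound 1 suffices, since the factor ['X] supplies the growth. *)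
Lemma poly_growth_ge1 P (M : R) : (1 < size P)%N ->
  exists r : R, forall y, r <= nn y -> M <= nn P.[y].
Proof.
elim/poly_ind: P M => [|P c IH] M; first by rewrite size_poly0.
rewrite size_MXaddC; case: ifP => // _; rewrite ltnS => sP.
have [sP1|sP1] := leqP (size P) 1.
  have [b b0 ->] : exists2 b, b != 0 & P = b%:P by apply/size_poly1P; rewrite eqn_leq sP1.
  have nb : 0 < nn b.
    rewrite lt_neqAle normc_nneg andbT eq_sym; apply: contra_neq b0.
    exact: ComplexField.Normc.eq0_normc.
  exists ((M + nn c) / nn b) => y; rewrite ler_pdivrMr// => My.
  rewrite hornerMXaddC hornerC; apply: le_trans (normcD_ge _ _).
  by rewrite ComplexField.Normc.normcM; lra.
have [r rP] := IH 1 sP1; exists (`|r| + `|M| + nn c) => y ry.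
rewrite hornerMXaddC; apply: le_trans (normcD_ge _ _).
rewrite ComplexField.Normc.normcM.
have nc := normc_nneg c; have ny := normc_nneg y; have r1 := ler_norm r; have M1 := ler_norm M.
have P1 : 1 <= nn P.[y] by apply: rP; have := normr_ge0 M; lra.
have : nn y <= nn P.[y] * nn y by rewrite ler_peMl.
have := normr_ge0 r; lra.
Qed.

(** The quotient of the polynomial by ['X] is still non-constant, hence eventually at least
    [M + nn c] in modulus, and the term [nn c] absorbs the constant coefficient once [nn y >= 1]. *)
Lemma poly_growth P (M : R) : (2 < size P)%N ->
  exists2 r : R, 0 <= r & forall y, r <= nn y -> M * nn y <= nn P.[y].
Proof.
elim/poly_ind: P => [|P c _]; first by rewrite size_poly0.
rewrite size_MXaddC; case: ifP => // _; rewrite ltnS => sP.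
have [r rP] := poly_growth_ge1 P (M + nn c) sP.
exists (`|r| + 1); first by rewrite addr_ge0.
move=> y ry; rewrite hornerMXaddC; apply: le_trans (normcD_ge _ _).
rewrite ComplexField.Normc.normcM.
have nc := normc_nneg c; have ny := normc_nneg y; have r1 := ler_norm r.
have y1 : 1 <= nn y by have := normr_ge0 r; lra.
have P1 : M + nn c <= nn P.[y] by apply: rP; lra.
have : (M + nn c) * nn y <= nn P.[y] * nn y by rewrite ler_wpM2r.
have : nn c <= nn c * nn y by rewrite ler_peMr.
lra.
Qed.

(* [cone k r true] is a neighbourhood of the point [1:0] at infinity, and
   [cone k r false] one of [0:1]. *)
Definition cone (k r : R) (c : bool) z : Prop :=
  r < sqn z /\ (if c then nn z.2 <= k * nn z.1 else nn z.1 <= k * nn z.2).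

Lemma cone_arith (k r X Y W : R) : 0 < k -> 0 <= X -> 0 <= Y ->
  k * X < Y -> r < X ^+ 2 + Y ^+ 2 -> (1 + k^-1) * Y <= W ->
  Y <= k * W /\ r < Y ^+ 2 + W ^+ 2.
Proof.
move=> k0 X0 Y0 kXY rXY YW.
have XW : X <= W.
  apply: le_trans YW; have : X <= k^-1 * Y by rewrite mulrC ler_pdivlMr// mulrC ltW.
  lra.
split; last first.
  by apply: lt_le_trans rXY _; rewrite addrC lerD2l ler_sqr ?nnegrE// (le_trans X0).
have := ler_wpM2l (ltW k0) YW; rewrite mulrA mulrDr divff ?gt_eqF// mulr1.
have : 0 <= k * Y by rewrite mulr_ge0 // ltW.
lra.
Qed.

(** Off the cone, [X ^+ 2 + Y ^+ 2] is at most [(1 + k ^- 2) * Y ^+ 2], so a large norm forces a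
    large [Y]. *)
Lemma radius_arith (k rho r X Y : R) : 0 < k -> 0 <= rho -> 0 <= X -> 0 <= Y ->
  rho ^+ 2 * (1 + k ^- 2) <= r -> k * X < Y -> r < X ^+ 2 + Y ^+ 2 -> rho <= Y.
Proof.
move=> k0 rho0 X0 Y0 rhor kXY rXY; rewrite leNgt; apply/negP => Yrho.
have XY : X <= k^-1 * Y by rewrite mulrC ler_pdivlMr// mulrC ltW.
have : X ^+ 2 <= k^-2 * Y ^+ 2.
  by rewrite -exprVn -exprMn ler_sqr ?nnegrE// mulr_ge0// invr_ge0 ltW.
have : Y ^+ 2 <= rho ^+ 2 by rewrite ler_sqr ?nnegrE// ltW.
have : 0 <= k^-2 by rewrite invr_ge0 sqr_ge0.
nra.
Qed.

Lemma henon_cone P delta (k : R) : (2 < size P)%N -> 0 < k ->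
  exists r0 : R, forall r z, r0 <= r ->
    r < sqn z -> ~ cone k r true z -> cone k r false (henon P delta z).
Proof.
move=> sP k0.
(* The part [1 + k^-1] is what [cone_arith] requires; the rest compensates [delta * z.1], as
   [nn z.1 <= k^-1 * nn z.2] off the cone. *)
have [rho rho0 grow] := poly_growth P (1 + k^-1 + nn delta * k^-1) sP.
exists (rho ^+ 2 * (1 + k ^- 2)) => r z rr rz nc.
have kXY : k * nn z.1 < nn z.2 by rewrite ltNge; apply/negP => h; exact: nc.
have rz' := rz; rewrite sqnE in rz'.
have X0 := normc_nneg z.1; have Y0 := normc_nneg z.2.
have := grow z.2 (radius_arith _ _ _ _ _ k0 rho0 X0 Y0 rr kXY rz').
move=> gr; rewrite /cone sqnE /=.
have XY : nn z.1 <= k^-1 * nn z.2 by rewrite mulrC ler_pdivlMr// mulrC ltW.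
have [] := cone_arith k r (nn z.1) (nn z.2) (nn (P.[z.2] - delta * z.1)) k0 X0 Y0 kXY rz'.
  apply: le_trans (normcB_ge _ _); rewrite ComplexField.Normc.normcM.
  have : nn delta * nn z.1 <= nn delta * (k^-1 * nn z.2) by rewrite ler_wpM2l// normc_nneg.
  lra.
by split.
Qed.

Lemma henon_inv_cone P delta (k : R) : (2 < size P)%N -> delta != 0 -> 0 < k ->
  exists r0 : R, forall r z, r0 <= r ->
    r < sqn z -> ~ cone k r false z -> cone k r true (henon_inv P delta z).
Proof.
move=> sP d0 k0.
have nd : 0 < nn delta.
  rewrite lt_neqAle normc_nneg andbT eq_sym; apply: contra_neq d0.
  exact: ComplexField.Normc.eq0_normc.
(* The factor [nn delta] offsets the division by [delta], and the last [k^-1] compensates the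
   subtraction of [z.2]. *)
have [rho rho0 grow] := poly_growth P ((1 + k^-1) * nn delta + k^-1) sP.
exists (rho ^+ 2 * (1 + k ^- 2)) => r z rr rz nc.
have kXY : k * nn z.2 < nn z.1 by rewrite ltNge; apply/negP => h; exact: nc.
have rz' := rz; rewrite sqnE addrC in rz'.
have X0 := normc_nneg z.2; have Y0 := normc_nneg z.1.
have := grow z.1 (radius_arith _ _ _ _ _ k0 rho0 X0 Y0 rr kXY rz').
move=> gr; rewrite /cone sqnE /= [_ + nn z.1 ^+ 2]addrC.
have XY : nn z.2 <= k^-1 * nn z.1 by rewrite mulrC ler_pdivlMr// mulrC ltW.
have [] := cone_arith k r (nn z.2) (nn z.1) (nn ((P.[z.1] - z.2) / delta)) k0 X0 Y0 kXY rz'.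
  rewrite ComplexField.Normc.normcM ComplexField.Normc.normcV ler_pdivlMr//.
  apply: le_trans (normcB_ge _ _).
  lra.
by split.
Qed.

Lemma cone_disj (k r : R) z : k < 1 -> 0 <= r ->
  cone k r true z -> cone k r false z -> False.
Proof.
move=> k1 r0 [rz /= h1] [_ /= h2]; rewrite sqnE in rz.
have X0 := normc_nneg z.1; have Y0 := normc_nneg z.2.
have X : nn z.1 <= 0 by nra.
have Y : nn z.2 <= 0 by nra.
nra.
Qed.

Lemma sqn_rot t z : sqn (rotC2 t z) = sqn z.
Proof.
case: z => [[a b] [c e]]; rewrite /sqn /rotC2 /=.
have := cos2Dsin2 t; set C := cos t; set S := sin t => CS.
transitivity ((C ^+ 2 + S ^+ 2) * (a ^+ 2 + b ^+ 2 + (c ^+ 2 + e ^+ 2))); first ring.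
by rewrite CS mul1r.
Qed.

Lemma rotK t : cancel (rotC2 t) (@rotC2 R (- t)).
Proof.
case=> [[a b] [c e]]; rewrite /rotC2 /= cosN sinN.
have := cos2Dsin2 t; set C := cos t; set S := sin t => CS.
have E (u : R) : u = (C ^+ 2 + S ^+ 2) * u by rewrite CS mul1r.
by congr ((_ +i* _)%C, (_ +i* _)%C); rewrite [RHS]E; ring.
Qed.

(** If [X] is the larger coordinate modulus of [z], both coordinates of the rotated point have
    modulus at least [4 * k * X - k * X] and at most [(1 + k) * X]. Lying in a cone would then give
    [3 * k * X <= 2 * k * X] with [X > 0]. *)
Lemma cone_rot t (k r : R) c c' z :
  0 < k -> k <= 1 -> 4 * k <= `|cos t| -> 4 * k <= `|sin t| -> 0 <= r ->
  cone k r c z -> cone k r c' (rotC2 t z) -> False.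
Proof.
move=> k0 k1 kc ks r0 [rz cz] [_ cz'].
have X0 := normc_nneg z.1; have Y0 := normc_nneg z.2; rewrite sqnE in rz.
have c1 : `|cos t| <= 1 by rewrite ler_norml cos_geN1 cos_le1.
have s1 : `|sin t| <= 1 by rewrite ler_norml sin_geN1 sin_le1.
have := normcB_ge ((cos t)%:C%C * z.1) ((sin t)%:C%C * z.2).
have := normcB_ge ((sin t)%:C%C * z.2) ((cos t)%:C%C * z.1).
have := normcD_ge ((sin t)%:C%C * z.1) ((cos t)%:C%C * z.2).
have := normcD_ge ((cos t)%:C%C * z.2) ((sin t)%:C%C * z.1).
have := le_normcD ((cos t)%:C%C * z.1) (- ((sin t)%:C%C * z.2)).
have := le_normcD ((sin t)%:C%C * z.1) ((cos t)%:C%C * z.2).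
rewrite -(opprB ((cos t)%:C%C * z.1)) !normcN (addrC ((cos t)%:C%C * z.2)).
rewrite !ComplexField.Normc.normcM !normc_real.
move: cz'; rewrite /cone /rotC2 /=.
set A := nn (_ - _); set D := nn (_ + _).
move: cz kc ks c1 s1 rz X0 Y0.
move: (nn z.1) (nn z.2) `|cos t| `|sin t| A D => X Y C S A D.
move=> cz kc ks c1 s1 rz X0 Y0 cz' D1 A1 D2 D3 A2 A3.
have CX : C * X <= X by rewrite ler_piMl.
have CY : C * Y <= Y by rewrite ler_piMl.
have SX : S * X <= X by rewrite ler_piMl.
have SY : S * Y <= Y by rewrite ler_piMl.
have kCX : 4 * k * X <= C * X by rewrite ler_wpM2r.
have kCY : 4 * k * Y <= C * Y by rewrite ler_wpM2r.
have kSX : 4 * k * X <= S * X by rewrite ler_wpM2r.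
have kSY : 4 * k * Y <= S * Y by rewrite ler_wpM2r.
have kX : k * X <= X by rewrite ler_piMl.
have kY : k * Y <= Y by rewrite ler_piMl.
have AXY : k * A <= k * (X + Y) by rewrite ler_pM2l//; lra.
have DXY : k * D <= k * (X + Y) by rewrite ler_pM2l//; lra.
have kkX : k * (k * X) <= k * X by rewrite ler_pM2l.
have kkY : k * (k * Y) <= k * Y by rewrite ler_pM2l.
have kcz : if c then k * Y <= k * (k * X) else k * X <= k * (k * Y).
  by case: c cz => cz; rewrite ler_pM2l.
have XY0 : 0 < X + Y.
  rewrite lt_neqAle addr_ge0// andbT; apply/eqP => XY; move: rz.
  have -> : X = 0 by lra.
  have -> : Y = 0 by lra.
  by rewrite !expr0n addr0 ltNge r0.
have kXY0 : 0 < k * (X + Y) by rewrite mulr_gt0.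
case: c cz kcz => cz kcz; case: c' cz' => cz'; lra.
Qed.

End HenonCones.

(** * Application to the two Hénon maps *)

Section Assembly.
Context {R : realType}.

Lemma sin_neq0 (t : R) : 0 < t < 2 * pi -> t != pi -> sin t != 0.
Proof.
move=> /andP[t0 t2] tpi; have [tp|tp|tp] := ltgtP t pi.
- by rewrite gt_eqF// sin_gt0_pi// t0.
- rewrite -(subrK pi t) sinDpi oppr_eq0 gt_eqF// sin_gt0_pi//; apply/andP; split; lra.
- by rewrite tp eqxx in tpi.
Qed.

Lemma cos_neq0 (t : R) : 0 < t < 2 * pi -> t != pi / 2 -> t != 3 * pi / 2 ->
  cos t != 0.
Proof.
move=> /andP[t0 t2] t1 t3; have [tp|tp|tp] := ltgtP t (pi / 2).
- by rewrite gt_eqF// cos_gt0_pihalf//; apply/andP; split=> //; lra.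
- rewrite -[cos t]opprK -sinBpihalf oppr_eq0; apply: sin_neq0.
    by apply/andP; split; have := pi_gt0 R; lra.
  by apply: contra_neq t3 => e; lra.
- by rewrite tp eqxx in t1.
Qed.

(** The summands come in the order [h1], [h2], [h1i], [h2i] of [stationary]. *)
Lemma sum_letters (V : nmodType) (F : bool * bool -> V) :
  (\sum_t F t = F (false, false) + F (true, false) + F (false, true) + F (true, true))%R.
Proof.
transitivity (\sum_b \sum_c F (b, c)).
  by rewrite pair_bigA; apply: eq_bigr => -[].
rewrite !big_bool /=.
by rewrite (AC (2*2) (4*2*3*1)).
Qed.

Lemma to_C2K : cancel (@to_C2 R) (@of_C2 R).
Proof. by case=> [[a b] [c e]]. Qed.

Lemma of_C2K : cancel (@of_C2 R) (@to_C2 R).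
Proof. by case=> [[a b] [c e]]. Qed.

Lemma to_C2_iter (F : C2 R -> C2 R) n p :
  to_C2 (iter n (onR4 F) p) = iter n F (to_C2 p).
Proof. by elim: n => //= n <-; rewrite /onR4 of_C2K. Qed.

Lemma henonK (P : {poly complex R}) delta : delta != 0 ->
  cancel (henon P delta) (henon_inv P delta).
Proof.
by move=> d0 [x y]; rewrite /henon /henon_inv /= subKr mulrC mulKf.
Qed.

Lemma henon_invK (P : {poly complex R}) delta : delta != 0 ->
  cancel (henon_inv P delta) (henon P delta).
Proof.
by move=> d0 [x y]; rewrite /henon /henon_inv /= mulrC divfK// subKr.
Qed.

Lemma ball_charged (mu : probability (R4 R) R) (r0 : R) :
  exists2 r, r0 <= r & mu [set p | sqn (to_C2 p) <= r] != 0%E.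
Proof.
pose B n := [set p : R4 R | sqn (to_C2 p) <= r0 + n%:R].
have [[n Bn]|none] := pselect (exists n, mu (B n) != 0%E).
  by exists (r0 + n%:R); rewrite ?lerDl.
have : mu.-negligible (\bigcup_n B n).
  apply: negligible_bigcup => n; exists (B n); split => //.
    exact: measurable_sqn_ball.
  by apply: contrapT => Bn; apply: none; exists n; apply/eqP.
suff -> : \bigcup_n B n = setT.
  move=> /(measure_negligible measurableT) mu0.
  by have := probability_setT mu; rewrite mu0 => /esym/eqP; rewrite onee_eq0.
apply/seteqP; split=> // p _; exists (Num.bound `|sqn (to_C2 p) - r0|) => //.
by rewrite /B /= -lerBlDl (le_trans (ler_norm _))// ltW// archi_boundP.
Qed.

Lemma filled_julia_sqn (h hinv : C2 R -> C2 R) z (r : R) :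
  (forall k, sqn (iter k h z) <= r) -> (forall k, sqn (iter k hinv z) <= r) ->
  filled_julia h hinv z.
Proof.
(* A modulus [u] with [u ^+ 2 <= r] satisfies [u <= r + 1]. *)
move=> hr hir; exists (r + 1) => n.
have {hr hir} : sqn (iterz h hinv n z) <= r by case: n => k; [exact: hr|exact: hir].
move: (iterz h hinv n z) => w; rewrite sqnE => wr.
rewrite !normc_def !lecR.
have := normc_nneg w.1; have := normc_nneg w.2; move: wr; rewrite /ComplexField.Normc.normc.
case: (w) => [[a b] [c e]] /= wr w1 w2; split; nra.
Qed.

End Assembly.

Theorem theoremC (R : realType) (P : {poly complex R}) (delta : complex R)
  (theta a1 a2 a3 a4 : R) :
  (2 < size P)%N ->
  delta != 0 ->
  0 < theta < 2 * pi ->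
  theta != pi / 2 -> theta != pi -> theta != 3 * pi / 2 ->
  0 < a1 -> 0 < a2 -> 0 < a3 -> 0 < a4 -> a1 + a2 + a3 + a4 = 1 ->
  let h1 := henon P delta in
  let h1i := henon_inv P delta in
  let h2 := rotC2 (- theta) \o h1 \o rotC2 theta in
  let h2i := rotC2 (- theta) \o h1i \o rotC2 theta in
  filled_julia h1 h1i `&` filled_julia h2 h2i = set0 ->
  forall mu : probability (R4 R) R, ~ stationary mu a1 a2 a3 a4 h1 h2 h1i h2i.
Proof.
move=> sP d0 th02 th1 th2 th3 a10 a20 a30 a40 asum h1 h1i h2 h2i disj mu stat.
pose H (t : bool * bool) : C2 R -> C2 R :=
  let g := if t.2 then h1i else h1 in
  if t.1 then rotC2 (- theta) \o g \o rotC2 theta else g.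
pose a (t : bool * bool) : R :=
  if t.1 then if t.2 then a4 else a2 else if t.2 then a3 else a1.
(* The aperture is chosen to meet the two bounds of [cone_rot]; the angles excluded by hypothesis
   are those where it would vanish. *)
pose k := Num.min `|cos theta| `|sin theta| / 4.
have ct : 0 < `|cos theta| by rewrite normr_gt0 cos_neq0.
have st : 0 < `|sin theta| by rewrite normr_gt0 sin_neq0.
have k0 : 0 < k by rewrite divr_gt0// lt_min ct st.
have kc : 4 * k <= `|cos theta| by rewrite mulrC divfK// ge_min lexx.
have ks : 4 * k <= `|sin theta| by rewrite mulrC divfK// ge_min lexx orbT.
have k1 : k < 1.
  by have : `|cos theta| <= 1 by [rewrite ler_norml cos_geN1 cos_le1]; lra.
have [r1 cone1] := henon_cone P delta k sP k0.
have [r2 cone2] := henon_inv_cone P delta k sP d0 k0.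
(* The absolute values make [r] nonnegative and at least both thresholds. *)
have [r rr B0] := ball_charged mu (`|r1| + `|r2|).
have r0 : 0 <= r by apply: le_trans rr; rewrite addr_ge0.
have r1r : r1 <= r by apply: le_trans rr; rewrite (le_trans (ler_norm _))// lerDl.
have r2r : r2 <= r by apply: le_trans rr; rewrite (le_trans (ler_norm _))// lerDr.
(* In the coordinates [w b], the generator selected by [b] is the plain Hénon map, so its cones are
   the standard ones. *)
pose w (b : bool) (p : R4 R) : C2 R := if b then rotC2 theta (to_C2 p) else to_C2 p.
have sqn_w b p : sqn (w b p) = sqn (to_C2 p) by case: b; rewrite /w ?sqn_rot.
have wH t p : w t.1 (onR4 (H t) p) = (if t.2 then h1i else h1) (w t.1 p).
  case: t => [[] c]; rewrite /w /onR4 of_C2K /H //=.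
  by rewrite -{1}[theta]opprK rotK.
have [||||||||||x Bx xB] := @pingpong_trapped _ _ _ mu (fun t => onR4 (H t)) a
   [set p | sqn (to_C2 p) <= r] (fun t => [set p | cone k r t.2 (w t.1 p)]).
- move=> [b c]; apply: measurable_onR4; rewrite /H /=.
  have mg : C2_measurable (if c then h1i else h1).
    by case: c; [exact: C2_measurable_henon_inv|exact: C2_measurable_henon].
  case: b => //; apply: C2_measurable_comp; last exact: C2_measurable_rot.
  by apply: C2_measurable_comp => //; exact: C2_measurable_rot.
- by case=> [[] []].
- by rewrite sum_letters.
- by move=> A mA; rewrite sum_letters; exact: stat.
- exact: measurable_sqn_ball.
- exact: B0.
- move=> t p; rewrite -[RHS]to_C2K /onR4 of_C2K; congr of_C2.
  have g1 : cancel h1 h1i by exact: henonK.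
  have g2 : cancel h1i h1 by exact: henon_invK.
  have rK q : rotC2 theta (rotC2 (- theta) q) = q by rewrite -{1}[theta]opprK rotK.
  by case: t => [[] []]; rewrite /H /= ?rK ?g1 ?g2 ?rotK.
- by move=> t p [] /=; rewrite sqn_w ltNge => /negP.
(* Cones of different generators are separated by the rotation, those of a map and its inverse by
   [k < 1]. *)
- move=> [b c] [b' c'] p; rewrite /= => Us Ut.
  have eb : b = b'.
    case: b b' Us Ut => [] [] // Us Ut.
      by have := cone_rot _ _ _ _ _ _ k0 (ltW k1) kc ks r0 Ut Us.
    by have := cone_rot _ _ _ _ _ _ k0 (ltW k1) kc ks r0 Us Ut.
  rewrite -eb in Ut *; congr (_, _).
  case: c c' Us Ut => [] [] // Us Ut; first by have := cone_disj _ _ _ k1 r0 Us Ut.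
  by have := cone_disj _ _ _ k1 r0 Ut Us.
- move=> [b c] p /= nB nU; rewrite [w _ _](wH (b, c)) /=.
  have rp : r < sqn (w b p) by rewrite sqn_w ltNge; exact/negP.
  by case: c nU => nU; [exact: cone2|exact: cone1].
apply/eqP: disj; apply/set0P; exists (to_C2 x).
have bd t n : sqn (iter n (H t) (to_C2 x)) <= r by rewrite -to_C2_iter; exact: xB.
split; apply: (filled_julia_sqn _ _ _ r) => n.
- exact: (bd (false, false)).
- exact: (bd (false, true)).
- exact: (bd (true, false)).
- exact: (bd (true, true)).
Qed.
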